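(* Every Borel subalgebra $\mathfrak{b}$ of $\mathfrak{g}=\mathfrak{gl}(n+1,\mathbb{C})$ contains strongly regular elements of $\mathfrak{g}$.
   Context: For $x\in\mathfrak{g}$ and $1\le i\le n+1$, $x_i$ denotes the upper left $i\times i$ submatrix of $x$, and $f_{i,j}(x)=\mathrm{Tr}(x_i^j)$ for $1\le j\le i\le n+1$. An element $x\in\mathfrak{g}$ is strongly regular if the differentials $\{df_{i,j}(x):1\le j\le i\le n+1\}$ are linearly independent in $T_x^*\mathfrak{g}$. *)

(* Defs.v *)
From mathcomp Require Import all_boot all_algebra.
From mathcomp Require Import reals Rstruct complex.
Set Implicit Arguments. Unset Strict Implicit. Unset Printing Implicit Defensive.
Import GRing.Theory Num.Theory.
Local Open Scope ring_scope.

Definition CC : numClosedFieldType := (Rdefinitions.R)[i].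

Definition gl (n : nat) := 'M[CC]_(n.+1).

Definition lie_bracket (n : nat) (a b : gl n) : gl n := a *m b - b *m a.

Definition is_subspace (n : nat) (S : gl n -> Prop) : Prop :=
  S 0 /\ (forall a b, S a -> S b -> S (a + b)) /\
  (forall (c : CC) a, S a -> S (c *: a)).

Definition is_lie_subalgebra (n : nat) (S : gl n -> Prop) : Prop :=
  is_subspace S /\ (forall a b, S a -> S b -> S (lie_bracket a b)).

Definition derived (n : nat) (S : gl n -> Prop) : gl n -> Prop :=
  fun x => forall V : gl n -> Prop, is_subspace V ->
    (forall a b, S a -> S b -> V (lie_bracket a b)) -> V x.

Fixpoint derived_series (n : nat) (S : gl n -> Prop) (k : nat) : gl n -> Prop :=
  if k is k'.+1 then derived (derived_series S k') else S.

Definition is_solvable (n : nat) (S : gl n -> Prop) : Prop :=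
  exists k, forall x, derived_series S k x -> x = 0.

Definition is_borel (n : nat) (b : gl n -> Prop) : Prop :=
  is_lie_subalgebra b /\ is_solvable b /\
  (forall b' : gl n -> Prop, is_lie_subalgebra b' -> is_solvable b' ->
     (forall x, b x -> b' x) -> forall x, b' x -> b x).

(* Upper-left i x i submatrix of an (n+1)x(n+1) matrix (for 1 <= i <= n+1). *)
Definition ul_sub (R : Type) (n i : nat) (x : 'M[R]_(n.+1)) : 'M[R]_i :=
  \matrix_(a < i, c < i) x (inord a) (inord c).

Definition fij (n i j : nat) (x : gl n) : CC := \tr ((ul_sub i x) ^+ j).

(* Differential of the polynomial function f_{i,j} at x applied to the
   tangent vector y: the coefficient of t in the polynomial
   t |-> f_{i,j}(x + t y), i.e. d/dt f_{i,j}(x + t y) at t = 0. *)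
Definition dfij (n i j : nat) (x y : gl n) : CC :=
  (\tr ((ul_sub i (map_mx polyC x + 'X *: map_mx polyC y)) ^+ j))`_1.

Definition strongly_regular (n : nat) (x : gl n) : Prop :=
  forall c : nat -> nat -> CC,
    (forall y : gl n,
       \sum_(1 <= i < n.+2) \sum_(1 <= j < i.+1) c i j * dfij i j x y = 0) ->
    forall i j, (1 <= j)%N -> (j <= i)%N -> (i <= n.+1)%N -> c i j = 0.

(* Main.v *)
(** By Lie's theorem a maximal solvable subalgebra [b] is the stabilizer
    [{x | G x G^-1 lower triangular}] of a full flag.  Since [df_{i,j}(x)] is
    [y |-> j tr (x_i^(j-1) y_i)], strong regularity follows, by descending
    induction on [i], once no nonzero polynomial [p] of degree [< i] is such
    that the last row and the last column of [p(x_i)] vanish.  For each [i] this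
    is an open condition on [x], so it suffices to satisfy it in [b] for one
    [i] at a time.  If [x_i] has distinct eigenvalues, it means that every left
    eigenvector [h] of [x_i] either has nonzero last coordinate or occurs in
    the expansion of the last basis vector [e_i] on the eigenbasis.  A basis
    adapted both to the flag of [b] and to the standard flag (Bruhat
    decomposition) can be modified inside the flag of [b] to have this
    property. *)

Require Import Defs.
From mathcomp Require Import all_boot all_algebra all_fingroup.
From mathcomp Require Import reals Rstruct complex.
From mathcomp Require Import boolp zify.
Set Implicit Arguments. Unset Strict Implicit. Unset Printing Implicit Defensive.
Import GRing.Theory Num.Theory.
Local Open Scope ring_scope.

(** * Lie's theorem *)

(** A matrix of maximal rank among those with row space inside [P] works: appending a vector of [P]
    keeps the row space in [P], so it cannot raise the rank. *)
Lemma subspace_matrix (F : fieldType) N (P : 'rV[F]_N -> Prop) :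
    P 0 -> (forall u v, P u -> P v -> P (u + v)) ->
    (forall c v, P v -> P (c *: v)) ->
  exists V : 'M[F]_N, forall v, P v <-> (v <= V)%MS.
Proof.
move=> P0 PD PZ.
pose Q r := `[< exists V : 'M[F]_N, \rank V = r /\ forall v : 'rV_N, (v <= V)%MS -> P v >].
have exQ : exists r, Q r.
  exists 0; apply/asboolP; exists 0; rewrite mxrank0; split=> // v.
  by rewrite submx0 => /eqP ->.
have ubQ r : Q r -> (r <= N)%N.
  by move=> /asboolP [V [<- _]]; apply: rank_leq_row.
case: (ex_maxnP exQ ubQ) => r /asboolP [V [rV VP]] rmax.
exists V => v; split=> [Pv|/VP//].
have sVW : (V <= V + v)%MS by apply: addsmxSl.
have QW : Q (\rank (V + v)%MS).
  apply/asboolP; exists (V + v)%MS; split=> // w /sub_addsmxP [[u1 u2] /= ->].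
  apply: PD; first by apply: VP; apply: submxMl.
  by rewrite [u2]mx11_scalar mul_scalar_mx; apply: PZ.
have := mxrank_leqif_sup sVW; case=> le1 eq1.
have : \rank V == \rank (V + v)%MS by rewrite eqn_leq le1 rV rmax.
by rewrite eq1; apply: submx_trans; apply: addsmxSr.
Qed.

Lemma stable_eigenvector (F : closedFieldType) N (V a : 'M[F]_N) :
  V != 0 -> (V *m a <= V)%MS ->
  exists (v : 'rV_N) (c : F), [/\ v != 0, (v <= V)%MS & v *m a = c *: v].
Proof.
move=> V0 Va.
have /submxP [X XP] : (row_base V *m a <= row_base V)%MS by rewrite stablemx_row_base.
have : (0 < \rank V)%N by rewrite lt0n mxrank_eq0.
move: (\rank V) (row_base V) X XP (row_base_free V) (eq_row_base V) => r.
case: r => // r B X XP fB eB _.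
have /closed_rootP [c] : size (char_poly X) != 1 by rewrite size_char_poly.
rewrite -eigenvalue_root_char => /eigenvalueP [u uX u0].
exists (u *m B), c; split.
- by rewrite mulmx_free_eq0.
- by rewrite -eB submxMl.
by rewrite -mulmxA XP mulmxA uX scalemxAl.
Qed.

(** Induction on the rank of [V]. If some [x] in [S] is not scalar on [V], an eigenspace of [x] in
    [V] is nonzero, smaller, and stable under [S] by commutation on [V]; otherwise any nonzero
    vector of [V] will do. *)
Lemma commuting_common_eigenvector (F : closedFieldType) N (S : 'M[F]_N -> Prop)
    (V : 'M[F]_N) :
    V != 0 -> (forall x, S x -> (V *m x <= V)%MS) ->
    (forall x y, S x -> S y -> V *m x *m y = V *m y *m x) ->
  exists v : 'rV_N,
    [/\ v != 0, (v <= V)%MS & forall x, S x -> (v *m x <= v)%MS].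
Proof.
move: {2}(\rank V).+1 (ltnSn (\rank V)) => r; elim: r V => // r IH V rV V0 VS comm.
case: (pselect (exists x, S x /\ forall c, V *m x <> c *: V)) => [[x [Sx nx]]|ns]; last first.
  have /rowV0Pn [v vV v0] := V0.
  exists v; split=> // x Sx; apply/sub_rVP.
  have [c Vx] : exists c, V *m x = c *: V.
    by apply: contrapT => h; apply: ns; exists x; split=> // c e; apply: h; exists c.
  by exists c; case/submxP: vV => D ->; rewrite -mulmxA Vx scalemxAr.
have [v [c [v0 vV vx]]] := stable_eigenvector V0 (VS x Sx).
pose W := (V :&: kermx (x - c%:M))%MS.
have inW u : (u <= W)%MS = (u <= V)%MS && (u *m x == c *: u).
  by rewrite sub_capmx sub_kermx mulmxBr mul_mx_scalar subr_eq0.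
have WV : (W <= V)%MS by apply: capmxSl.
have WK : W *m x = c *: W.
  by have := submx_refl W; rewrite inW => /andP [_ /eqP].
have commU (u y z : 'M_N) : (u <= V)%MS -> S y -> S z -> u *m y *m z = u *m z *m y.
  by move=> /submxP [D ->] Sy Sz; rewrite -!mulmxA !(mulmxA V) comm // !mulmxA.
have [||y Sy|y z Sy Sz|w [w0 wW wS]] := IH W.
- have : \rank W != \rank V.
    have [_ ->] := mxrank_leqif_sup WV.
    apply/negP; rewrite sub_capmx submx_refl sub_kermx mulmxBr mul_mx_scalar subr_eq0.
    by move/eqP; apply: nx.
  by move=> neq; apply: leq_trans (_ : _ < \rank V)%N _; rewrite // ltn_neqAle neq mxrankS.
- by apply: contraNneq v0 => W0; rewrite -submx0 -W0 inW vV vx eqxx.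
- rewrite inW (submx_trans (submxMr _ WV)) ?VS //=.
  by rewrite commU // WK scalemxAl.
- exact: commU.
by exists w; split=> //; apply: submx_trans wW WV.
Qed.

Definition krylov_mx (F : fieldType) n (v : 'rV[F]_n.+1) (a : 'M[F]_n.+1) d : 'M[F]_(d, n.+1) :=
  \matrix_(i < d) (v *m a ^+ i).

Lemma krylov_mx_sub (F : fieldType) n (v : 'rV[F]_n.+1) a i d :
  (i < d)%N -> (v *m a ^+ i <= krylov_mx v a d)%MS.
Proof. by move=> id; rewrite -(rowK (fun i : 'I_d => v *m a ^+ i) (Ordinal id)) row_sub. Qed.

Lemma krylov_mx_mul (F : fieldType) n (v : 'rV[F]_n.+1) a d :
  (krylov_mx v a d *m a <= krylov_mx v a d.+1)%MS.
Proof.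
apply/row_subP => i; rewrite row_mul rowK -mulmxA -[a ^+ i *m a]/(a ^+ i * a) -exprSr.
by apply: krylov_mx_sub; rewrite ltnS.
Qed.

Lemma krylov_mxS (F : fieldType) n (v : 'rV[F]_n.+1) a d :
  (krylov_mx v a d <= krylov_mx v a d.+1)%MS.
Proof.
by apply/row_subP => i; rewrite rowK; apply: krylov_mx_sub; rewrite ltnS ltnW.
Qed.

(** For the largest [d] with independent rows, one more row does not raise the rank, so the span
    already contains its image under [a]. *)
Lemma krylov_stable (F : fieldType) n (v : 'rV[F]_n.+1) a : v != 0 ->
  exists d, [/\ (0 < d)%N, row_free (krylov_mx v a d)
    & (krylov_mx v a d *m a <= krylov_mx v a d)%MS].
Proof.
move=> v0; pose Q d := row_free (krylov_mx v a d).
have Q1 : Q 1%N.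
  have K1 : krylov_mx v a 1 = v.
    by apply/row_matrixP => i; rewrite rowK (ord1 i) expr0 mulmx1 row_id.
  by rewrite /Q K1 /row_free rank_rV v0.
have ubQ d : Q d -> (d <= n.+1)%N by move=> /eqP <-; apply: rank_leq_col.
have exQ : exists d, Q d by exists 1%N.
case: (ex_maxnP exQ ubQ) => d Qd dmax.
exists d; split=> //; first exact: dmax.
have nQ : ~~ Q d.+1 by apply/negP => /dmax; rewrite ltnn.
have [le1 eq1] := mxrank_leqif_sup (krylov_mxS v a d).
apply: submx_trans (krylov_mx_mul v a d) _.
rewrite -eq1 eqn_leq le1 /= (eqP Qd) -ltnS ltn_neqAle rank_leq_row andbT.
exact: nQ.
Qed.

(* On the cyclic space spanned by [v, va, va^2, ...] the operator [ha - ah] is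
   triangular with constant diagonal [w (ha - ah)], but it also is a
   commutator there, so its trace vanishes. *)
Lemma weight_commutator0 (F : numFieldType) n (I : 'M[F]_n.+1 -> Prop)
    (w : 'M[F]_n.+1 -> F) (v : 'rV[F]_n.+1) a :
    v != 0 -> (forall h, I h -> v *m h = w h *: v) ->
    (forall h, I h -> I (h *m a - a *m h)) ->
  forall h, I h -> w (h *m a - a *m h) = 0.
Proof.
move=> v0 vI aI.
pose K := krylov_mx v a.
(* The induction runs over all [h] at once and rests on [v a^(i+1) h = (v a^i h) a - v a^i (ha -
   ah)]. *)
have tri i : forall h, I h -> (v *m a ^+ i *m h - w h *: (v *m a ^+ i) <= K i)%MS.
  elim: i => [|i IH] h Ih.
    by rewrite expr0 mulmx1 vI // subrr sub0mx.
  have -> : v *m a ^+ i.+1 *m h - w h *: (v *m a ^+ i.+1)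
      = (v *m a ^+ i *m h - w h *: (v *m a ^+ i)) *m a
        - (v *m a ^+ i *m (h *m a - a *m h) - w (h *m a - a *m h) *: (v *m a ^+ i))
        - w (h *m a - a *m h) *: (v *m a ^+ i).
    rewrite exprSr -[a ^+ i * a]/(a ^+ i *m a) mulmxBl mulmxBr !mulmxA -scalemxAl.
    set A := _ *m h *m a; set B := _ *m a *m h; set C := w h *: _; set D := _ *: _.
    by rewrite !opprB [D + _]addrC addrA addrK addrC addrA subrK.
  have KS := krylov_mxS v a i.
  rewrite !addmx_sub //.
  - exact: submx_trans (submxMr _ (IH h Ih)) (krylov_mx_mul v a i).
  - by rewrite eqmx_opp; apply: submx_trans (IH _ (aI h Ih)) KS.
  by rewrite -scaleNr scalemx_sub // krylov_mx_sub.
have [d [d_gt0 Kfree Ka]] := krylov_stable a v0.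
have Kh h : I h -> (K d *m h <= K d)%MS.
  move=> Ih; apply/row_subP => i; rewrite row_mul rowK.
  rewrite -[v *m _ *m h](subrK (w h *: (v *m a ^+ i))) addmx_sub //.
    apply: submx_trans (tri i h Ih) _; apply/row_subP => j; rewrite rowK.
    by apply: krylov_mx_sub; apply: ltn_trans (ltn_ord j) (ltn_ord i).
  by rewrite scalemx_sub // krylov_mx_sub.
move=> h Ih; set h' := _ - _; have Ih' : I h' := aI h Ih.
have /submxP [A AK] := Ka; have /submxP [H HK] := Kh h Ih.
have /submxP [H' H'K] := Kh h' Ih'.
have trH' : \tr H' = 0.
  suff -> : H' = H *m A - A *m H by rewrite raddfB /= mxtrace_mulC subrr.
  apply: (row_free_inj Kfree); rewrite /= -H'K /h' mulmxBr mulmxBl !mulmxA.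
  by rewrite HK AK -!mulmxA HK AK !mulmxA.
(* By [tri] the remainder only involves the rows before [i], which [P] selects; since the rows of
   [K d] are independent, it does not affect the diagonal entry. *)
have diagH' i : H' i i = w h'.
  pose P : 'M[F]_(i, d) := \matrix_(j, l) (l == j :> nat)%:R.
  have KP : K i = P *m K d.
    apply/row_matrixP => j; rewrite row_mul rowK.
    have jd : (j < d)%N := ltn_trans (ltn_ord j) (ltn_ord i).
    have -> : row j P = delta_mx 0 (Ordinal jd).
      by apply/rowP => l; rewrite !mxE eqxx -val_eqE /=.
    by rewrite -rowE rowK.
  have /submxP [D] := tri i h' Ih'; rewrite KP mulmxA.
  have -> : v *m a ^+ i = row i (K d) by rewrite rowK.
  rewrite -row_mul H'K row_mul [row i (K d)]rowE scalemxAl -mulmxBl.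
  move/(row_free_inj Kfree)/rowP/(_ i); rewrite !mxE big1 => [|j _].
    by rewrite !eqxx mulr1 => /eqP; rewrite subr_eq0 => /eqP.
  by rewrite !mxE gtn_eqF ?mulr0 //; apply: ltn_ord.
move: trH'; rewrite /mxtrace (eq_bigr (fun=> w h')) // sumr_const card_ord.
by move/eqP; rewrite mulrn_eq0 eqn0Ngt d_gt0 => /eqP.
Qed.

Section LieTheorem.
Variable n : nat.
Implicit Type S : gl n -> Prop.

Lemma derived_subset S : is_lie_subalgebra S -> forall x, derived S x -> S x.
Proof. by move=> [sS bS] x; apply. Qed.

Lemma bracket_derived S a b : S a -> S b -> derived S (lie_bracket a b).
Proof. by move=> Sa Sb V _; apply. Qed.

Lemma derived_lie S : is_lie_subalgebra S -> is_lie_subalgebra (derived S).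
Proof.
move=> lS; split; last by move=> a b /derived_subset Sa /derived_subset Sb; apply: bracket_derived; auto.
split; first by move=> V [].
split=> [a b Sa Sb|c a Sa] V sV bV; have [_ [VD VZ]] := sV.
  by apply: VD; [apply: Sa|apply: Sb].
by apply: VZ; apply: Sa.
Qed.

Lemma derived_series_lie S k : is_lie_subalgebra S -> is_lie_subalgebra (derived_series S k).
Proof. by move=> lS; elim: k => //= k; apply: derived_lie. Qed.

(** The recursion peels off the last derivation; induction on the derived length needs the first
    one. *)
Lemma derived_seriesS S k : derived_series S k.+1 = derived_series (derived S) k.
Proof. by elim: k => //= k <-. Qed.

(* Lie's theorem, by induction on the derived length: a weight space of the
   derived algebra is stable, and there the brackets act by scalars of trace
   zero, so that the algebra acts on it by commuting operators. *)
Theorem lie_common_eigenvector S k :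
    is_lie_subalgebra S -> (forall x, derived_series S k x -> x = 0) ->
  exists2 v : 'rV[CC]_n.+1, v != 0 & forall x, S x -> (v *m x <= v)%MS.
Proof.
elim: k S => [|k IH] S lS Sk.
  exists (delta_mx 0 0); last by move=> x /Sk ->; rewrite mulmx0 sub0mx.
  by apply/negP => /eqP/rowP/(_ 0); rewrite !mxE => /eqP; rewrite oner_eq0.
have [|v v0 vS] := IH _ (derived_lie lS); first by rewrite -derived_seriesS.
have [j vj] : exists j, v 0 j != 0.
  by case/rV0Pn: v0 => j vj; exists j.
(* The weight of [v], read off at a nonzero coordinate. *)
pose w (h : 'M[CC]_n.+1) := (v *m h) 0 j / v 0 j.
have vw h : derived S h -> v *m h = w h *: v.
  by move=> /vS /sub_rVP [c vh]; rewrite /w vh mxE mulfK.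
have [V VP] : exists V : 'M[CC]_n.+1, forall u : 'rV_n.+1,
    (forall h, derived S h -> u *m h = w h *: u) <-> (u <= V)%MS.
  apply: subspace_matrix => [h _|u u' hu hu' h Sh|c u hu h Sh].
  - by rewrite mul0mx scaler0.
  - by rewrite mulmxDl hu // hu' // scalerDr.
  by rewrite -scalemxAl hu // !scalerA mulrC.
have V0 : V != 0.
  by apply: contraNneq v0 => V0; have /VP := vw; rewrite V0 submx0.
have VM m (u : 'M_(m, n.+1)) h : (u <= V)%MS -> derived S h -> u *m h = w h *: u.
  move=> uV Sh; apply/row_matrixP => i; rewrite row_mul linearZ /=.
  by apply: (VP _).2 => //; apply: submx_trans uV; apply: row_sub.
have w0 a h : S a -> derived S h -> w (h *m a - a *m h) = 0.
  move=> Sa; apply: (weight_commutator0 v0 vw) => h' Sh'.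
  by apply: bracket_derived => //; apply: derived_subset.
have Vstable a : S a -> (V *m a <= V)%MS.
  move=> Sa; apply/row_subP => i; apply/VP => h Sh; rewrite row_mul.
  have rV : (row i V <= V)%MS := row_sub i V.
  have -> : row i V *m a *m h = row i V *m h *m a - row i V *m (h *m a - a *m h).
    by rewrite mulmxBr !mulmxA opprB addrCA subrr addr0.
  rewrite (VM _ _ h) // (VM _ _ (h *m a - a *m h)) //.
    by rewrite w0 // scale0r subr0 scalemxAl.
  by apply: bracket_derived => //; apply: derived_subset.
have Vcomm x y : S x -> S y -> V *m x *m y = V *m y *m x.
  move=> Sx Sy; have Sxy := bracket_derived Sx Sy.
  suff wxy : w (lie_bracket x y) = 0.
    apply/eqP; rewrite -subr_eq0 -!mulmxA -mulmxBr.
    by rewrite (VM _ _ _ (submx_refl V) Sxy) wxy scale0r.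
  (* In a basis of the weight space, [x] and [y] become [X] and [Y], whose commutator is the scalar
     [w (lie_bracket x y)]; its trace is zero and the space is not, so the scalar is zero. *)
  have [B [Bfree BV Bstable]] : exists B : 'M_(\rank V, n.+1), [/\ row_free B,
      (B <= V)%MS & forall z, S z -> (B *m z <= B)%MS].
    exists (row_base V); rewrite row_base_free eq_row_base; split=> // z Sz.
    by rewrite stablemx_row_base; exact: Vstable.
  have /submxP [X BX] := Bstable x Sx; have /submxP [Y BY] := Bstable y Sy.
  have : \tr (X *m Y - Y *m X) = 0 by rewrite raddfB /= mxtrace_mulC subrr.
  have -> : X *m Y - Y *m X = (w (lie_bracket x y))%:M.
    apply: (row_free_inj Bfree); rewrite /= mulmxBl -!mulmxA -BX -BY !mulmxA -BX -BY.
    by rewrite mul_scalar_mx -(VM _ _ _ BV Sxy) mulmxBr !mulmxA.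
  rewrite mxtrace_scalar => /eqP; rewrite mulrn_eq0 mxrank_eq0 (negbTE V0).
  by move/eqP.
have [u [u0 _ uS]] := commuting_common_eigenvector V0 Vstable Vcomm.
by exists u.
Qed.

End LieTheorem.

(** The image of a derived algebra is a subspace containing the brackets of images. As [f] respects
    brackets only on [S], the proof also needs the derived series to stay inside [S]. This transfers
    solvability to a quotient action. *)
Lemma derived_series_image n m (S : gl n -> Prop) (f : gl n -> gl m) k :
    is_lie_subalgebra S -> linear f ->
    (forall a b, S a -> S b -> f (lie_bracket a b) = lie_bracket (f a) (f b)) ->
  forall y, derived_series (fun y => exists2 x, S x & y = f x) k y ->
  exists2 x, derived_series S k x & y = f x.
Proof.
move=> lS lf fb; elim: k => [//|k IH] y /= Dy.
apply: (Dy (fun y => exists2 x, derived (derived_series S k) x & y = f x)).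
  have [[D0 [DD DZ]] _] := derived_lie (derived_series_lie k lS).
  have f0 : f 0 = 0 by have := lf (-1) 0 0; rewrite scaleN1r !addNr scaleN1r addNr.
  split; first by exists 0.
  split=> [_ _ [a Da ->] [b Db ->]|c _ [a Da ->]].
    by exists (a + b); [exact: DD|have := lf 1 a b; rewrite !scale1r].
  by exists (c *: a); [exact: DZ|have := lf c a 0; rewrite f0 !addr0].
have DS j : forall x, derived_series S j x -> S x.
  elim: j => //= j IHj x Dx; apply/IHj.
  exact: (derived_subset (derived_series_lie j lS)).
move=> _ _ /IH [a Da ->] /IH [b Db ->]; exists (lie_bracket a b).
  exact: bracket_derived.
by rewrite fb //; apply: (DS k).
Qed.

(** Induction on the size: a common eigenvector, taken as first basis row, clears the upper right
    block. The lower right block is then a Lie morphism on [S], and its solvable image is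
    triangularized by induction. *)
Theorem lie_triangularization n (S : gl n -> Prop) :
    is_lie_subalgebra S -> is_solvable S ->
  exists2 G : gl n, G \in unitmx & forall x, S x -> is_trig_mx (G *m x *m invmx G).
Proof.
elim: n S => [|n IH] S lS [k Sk].
  by exists 1%:M; rewrite ?unitmx1 // => x _; apply: mx11_is_trig.
have [v v0 vS] := lie_common_eigenvector lS Sk.
pose G0 : 'M[CC]_(1 + n.+1) := row_ebase v.
have G0u : G0 \in unitmx := row_ebase_unit v.
have vG0 : exists2 c, c != 0 & v = c *: row 0 G0.
  have := mulmx_ebase v; rewrite rank_rV v0 [col_ebase v]mx11_scalar -mulmxA mul_scalar_mx.
  have -> : pid_mx true = delta_mx 0 0 :> 'M[CC]_(1, n.+2).
    by apply/rowP => j; rewrite !mxE -!val_eqE /= eq_sym; case: (val j).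
  rewrite -rowE => e; exists (col_ebase v 0 0) => //.
  by apply: contraNneq v0 => c0; rewrite -e c0 scale0r.
pose conj (x : gl n.+1) : 'M[CC]_(1 + n.+1) := G0 *m x *m invmx G0.
pose f (x : gl n.+1) : gl n := drsubmx (conj x).
have conjB a b : conj (lie_bracket a b) = conj a *m conj b - conj b *m conj a.
  by rewrite /conj /lie_bracket mulmxBr mulmxBl !mulmxA !mulmxKV.
have ur0 x : S x -> ursubmx (conj x) = 0.
  move=> Sx; have [c c0 vE] := vG0; have /sub_rVP [d vx] := vS x Sx.
  have e : row 0 (conj x) = d *: delta_mx 0 0.
    rewrite /conj !row_mul.
    have -> : row 0 G0 *m x = d *: row 0 G0.
      by apply: (scalerI c0); rewrite scalemxAl -vE vx scalerA mulrC -scalerA -vE.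
    by rewrite -scalemxAl rowE -mulmxA mulmxV // mulmx1.
  apply/matrixP => i j; rewrite !mxE (ord1 i).
  have := congr1 (fun w : 'rV_(1 + n.+1) => w 0 (rshift 1 j)) e.
  rewrite !mxE (_ : lshift _ 0 = 0) => [->|]; last by apply: val_inj.
  by rewrite -val_eqE /= mulr0.
have lf : linear f.
  move=> c a b; rewrite /f /conj mulmxDr mulmxDl -scalemxAr -scalemxAl.
  by apply/matrixP => i j; rewrite !mxE.
have fB a b : S a -> S b -> f (lie_bracket a b) = lie_bracket (f a) (f b).
  move=> Sa Sb; rewrite /f conjB /lie_bracket.
  rewrite -[conj a]submxK -[conj b]submxK !ur0 // !mulmx_block.
  rewrite opp_block_mx add_block_mx !block_mxKdr.
  by rewrite !mulmx0 !add0r.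
have [||G' G'u G'S] := IH (fun y => exists2 x, S x & y = f x).
- have [[S0 [SD SZ]] SB] := lS.
  have f0 : f 0 = 0 by have := lf (-1) 0 0; rewrite scaleN1r !addNr scaleN1r addNr.
  split; last by move=> _ _ [a Sa ->] [b Sb ->]; exists (lie_bracket a b); rewrite ?fB //; apply: SB.
  split; first by exists 0.
  split=> [_ _ [a Da ->] [b Db ->]|c _ [a Da ->]].
    by exists (a + b); [apply: SD|have := lf 1 a b; rewrite !scale1r].
  by exists (c *: a); [apply: SZ|have := lf c a 0; rewrite f0 !addr0].
- exists k => y /(derived_series_image lS lf fB) [x /Sk -> ->].
  by have := lf (-1) 0 0; rewrite scaleN1r !addNr scaleN1r addNr.
pose G1 : 'M[CC]_(1 + n.+1) := block_mx 1%:M 0 0 G'.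
pose G1' : 'M[CC]_(1 + n.+1) := block_mx 1%:M 0 0 (invmx G').
have G1K : G1 *m G1' = 1%:M.
  rewrite mulmx_block !mul1mx !mul0mx !mulmx0 !addr0 !add0r mulmxV //.
  by rewrite -scalar_mx_block.
have [G1u G1'u] := mulmx1_unit G1K.
exists (G1 *m G0) => [|x Sx]; first by rewrite unitmx_mul G1u.
have -> : invmx (G1 *m G0) = invmx G0 *m G1'.
  have G1E : G1' = invmx G1 by rewrite -[RHS]mulmx1 -G1K mulKmx.
  apply: (can_inj (mulKmx (_ : G1 *m G0 \in unitmx))); rewrite ?unitmx_mul ?G1u //.
  by rewrite mulmxV ?unitmx_mul ?G1u // !mulmxA mulmxK.
have -> : G1 *m G0 *m x *m (invmx G0 *m G1') = G1 *m conj x *m G1'.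
  by rewrite /conj !mulmxA.
rewrite -[conj x]submxK ur0 // !mulmx_block.
rewrite !mul1mx !mulmx1 !mul0mx !mulmx0 !addr0 !add0r.
rewrite [is_trig_mx _](is_trig_block_mx _ _ _ _ (erefl 1%N)) mul0mx eqxx mx11_is_trig /=.
by apply: G'S; exists x.
Qed.

(** * Borel subalgebras are stabilizers of flags *)

Lemma trig_mx_mul (R : pzSemiRingType) n (x y : 'M[R]_n) :
  is_trig_mx x -> is_trig_mx y -> is_trig_mx (x *m y).
Proof.
move=> /is_trig_mxP tx /is_trig_mxP ty; apply/is_trig_mxP => i j ij.
rewrite mxE big1 // => k _; case: (ltnP i k) => ik; first by rewrite tx ?mul0r.
by rewrite ty ?mulr0 //; apply: leq_ltn_trans ij.
Qed.

Lemma trig_mx_inv (F : fieldType) n (A : 'M[F]_n) :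
  A \in unitmx -> is_trig_mx A -> is_trig_mx (invmx A).
Proof.
move=> Au tA; have /is_trig_mxP tA' := tA; apply/is_trig_mxP => i.
have [r] := ubnP (val i); elim: r i => // r IH i; rewrite ltnS => ir j ij.
have : (A *m invmx A) i j = 0 by rewrite mulmxV // mxE -val_eqE ltn_eqF.
rewrite mxE (bigD1 i) //= big1 ?addr0 => [|k ki].
  move/eqP; rewrite mulf_eq0 => /orP [|/eqP //].
  move: Au; rewrite unitmxE det_trig // unitfE => /prodf_neq0 /(_ i isT).
  by move/negbTE ->.
case: (ltngtP i k) => [ik|ki'|/val_inj e]; first by rewrite tA' ?mul0r.
  by rewrite IH ?mulr0 //; [apply: leq_trans ir|apply: ltn_trans ij].
by rewrite e eqxx in ki.
Qed.

(** Nonzero entries lie at least [k] steps below the diagonal: [k = 0] means lower triangular,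
    [k = 1] strictly lower triangular, and [k = n.+1] forces zero. *)
Definition low_band n k (x : gl n) := forall i j : 'I_n.+1, (i < j + k)%N -> x i j = 0.

Lemma low_band_mul n k l (x y : gl n) :
  low_band k x -> low_band l y -> low_band (k + l) (x *m y).
Proof.
move=> bx by_ i j ij; rewrite mxE big1 // => p _.
case: (ltnP i (p + k)) => ip; first by rewrite bx ?mul0r.
by rewrite by_ ?mulr0 //; lia.
Qed.

Lemma trig_mul_diag n (x y : gl n) i :
  is_trig_mx x -> is_trig_mx y -> (x *m y) i i = x i i * y i i.
Proof.
move=> /is_trig_mxP tx /is_trig_mxP ty; rewrite mxE (bigD1 i) //= big1 ?addr0 // => p pi.
case: (ltngtP i p) => [ip|ip|/val_inj e]; first by rewrite tx ?mul0r.
  by rewrite ty ?mulr0.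
by rewrite e eqxx in pi.
Qed.

Lemma bracketE n (x y : gl n) i j : lie_bracket x y i j = (x *m y) i j - (y *m x) i j.
Proof. by rewrite mxE [X in _ + X]mxE. Qed.

Section Conjugate.
Variables (n : nat) (G : gl n).
Hypothesis Gu : G \in unitmx.

Let conj (x : gl n) : gl n := G *m x *m invmx G.

Let conjB a b : conj (lie_bracket a b) = lie_bracket (conj a) (conj b).
Proof. by rewrite /conj /lie_bracket mulmxBr mulmxBl !mulmxA !mulmxKV. Qed.

Let conj_linear : linear conj.
Proof. by move=> c a b; rewrite /conj mulmxDr mulmxDl -scalemxAr -scalemxAl. Qed.

Lemma conj_trig_lie : is_lie_subalgebra (fun x => is_trig_mx (G *m x *m invmx G)).
Proof.
have tZD c (a b : gl n) : is_trig_mx (conj a) -> is_trig_mx (conj b) ->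
    is_trig_mx (conj (c *: a + b)).
  rewrite conj_linear => /is_trig_mxP ta /is_trig_mxP tb; apply/is_trig_mxP => i j ij.
  by rewrite mxE [X in X + _]mxE ta // tb // mulr0 addr0.
have t0 : is_trig_mx (conj 0) by rewrite /conj mulmx0 mul0mx mx0_is_trig.
split; last first.
  move=> a b ta tb; rewrite -/(conj _) conjB.
  have /is_trig_mxP tab := trig_mx_mul ta tb; have /is_trig_mxP tba := trig_mx_mul tb ta.
  by apply/is_trig_mxP => i j ij; rewrite bracketE tab // tba // subrr.
split; first exact: t0.
split=> [a b ta tb|c a ta].
  by move: (tZD 1 a b ta tb); rewrite scale1r; apply.
by move: (tZD c a 0 ta t0); rewrite addr0; apply.
Qed.

(** The first bracket kills the diagonal, since diagonal entries of triangular matrices multiply;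
    each further one pushes the band at least one step down, until nothing is left. *)
Lemma conj_trig_solvable : is_solvable (fun x => is_trig_mx (G *m x *m invmx G)).
Proof.
exists n.+1 => x Dx.
suff bx : low_band n.+1 (conj x).
  have c0 : conj x = 0 by apply/matrixP => i j; rewrite bx ?mxE // ltn_addl.
  have -> : x = invmx G *m conj x *m G by rewrite /conj !mulmxA mulmxKV // mulVmx // mul1mx.
  by rewrite c0 mulmx0 mul0mx.
have sub k : is_subspace (fun x => low_band k (conj x)).
  split; first by move=> i j _; rewrite /conj mulmx0 mul0mx mxE.
  split=> [a b ba bb i j ij|c a ba i j ij].
    by have := conj_linear 1 a b; rewrite !scale1r => ->; rewrite mxE ba // bb // addr0.
  have := conj_linear c a 0; rewrite !addr0 => ->.
  by rewrite mxE [X in X + _]mxE ba // /conj mulmx0 mul0mx mxE mulr0 addr0.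
suff bk k y : derived_series (fun x => is_trig_mx (conj x)) k.+1 y -> low_band k.+1 (conj y).
  exact: bk.
elim: k y => [|k IH] {Dx}x Dx.
  apply: (Dx (fun x => low_band 1 (conj x))) => // a b ta tb i j.
  rewrite addn1 ltnS leq_eqVlt conjB bracketE => /orP [/eqP/val_inj <-|ij].
    by rewrite (trig_mul_diag i ta tb) (trig_mul_diag i tb ta) [X in X - _]mulrC subrr.
  have /is_trig_mxP tab := trig_mx_mul ta tb; have /is_trig_mxP tba := trig_mx_mul tb ta.
  by rewrite tab // tba // subrr.
apply: (Dx (fun x => low_band k.+2 (conj x))) => // a b /IH ba /IH bb i j ij.
have bab := low_band_mul ba bb; have bba := low_band_mul bb ba.
by rewrite conjB bracketE bab ?bba ?subrr //; lia.
Qed.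

End Conjugate.

(** Lie's theorem puts [b] inside the stabilizer of a flag, which is itself a solvable subalgebra;
    maximality gives equality. *)
Lemma borel_conj_trig n (b : gl n -> Prop) : is_borel b ->
  exists2 G : gl n, G \in unitmx & forall x, b x <-> is_trig_mx (G *m x *m invmx G).
Proof.
move=> [lb [sb bmax]]; have [G Gu bG] := lie_triangularization lb sb.
exists G => // x; split; first exact: bG.
exact: bmax (conj_trig_lie Gu) (conj_trig_solvable Gu) bG x.
Qed.

(** * Existence for a single corner *)

(* The row of index [s k] of [L] is minimal for the property that its image
   under [G] starts with a 1 in column [k]. *)
Lemma bruhat_row_perm (F : fieldType) n (G : 'M[F]_n.+1) : G \in unitmx ->
  exists (L : 'M[F]_n.+1) (s : 'S_n.+1),
    [/\ is_trig_mx L, L \in unitmx,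
        forall k, (row_perm s L *m G) k k = 1
      & forall k j : 'I_n.+1, (j < k)%N -> (row_perm s L *m G) k j = 0].
Proof.
move=> Gu.
pose lead (k : 'I_n.+1) (l : 'rV[F]_n.+1) :=
  (l *m G) 0 k = 1 /\ forall j : 'I_n.+1, (j < k)%N -> (l *m G) 0 j = 0.
pose below (i : nat) (l : 'rV[F]_n.+1) := forall j : 'I_n.+1, (i <= j)%N -> l 0 j = 0.
have minrow k : exists il : 'I_n.+1 * 'rV[F]_n.+1,
    [/\ lead k il.2, below il.1.+1 il.2 & forall l, lead k l -> below il.1 l -> False].
  pose Q i := `[< exists l, lead k l /\ below i l >].
  have exQ : exists i, Q i.
    exists n.+1; apply/asboolP; exists (delta_mx 0 k *m invmx G).
    split; last by move=> j; rewrite leqNgt ltn_ord.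
    split=> [|j jk]; rewrite mulmxKV // mxE eqxx /= ?eqxx //.
    by rewrite -val_eqE ltn_eqF.
  case: (ex_minnP exQ) => i /asboolP [l [lk li]] imin.
  have i_gt0 : (0 < i)%N.
    rewrite lt0n; apply: contra_eq_neq (proj1 lk) => i0.
    have -> : l = 0 by apply/rowP => j; rewrite li ?i0 // mxE.
    by rewrite mul0mx mxE eq_sym oner_eq0.
  have i_le : (i.-1 < n.+1)%N.
    by rewrite prednK //; apply: imin; apply/asboolP; exists l; split=> // j; rewrite leqNgt ltn_ord.
  exists (Ordinal i_le, l) => /=; rewrite prednK //; split=> // l' l'k l'i.
  have /imin : Q i.-1 by apply/asboolP; exists l'.
  by case: (i) i_gt0 => //= i' _; rewrite ltnn.
have [il ilP] := fin_all_exists minrow.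
pose s (k : 'I_n.+1) : 'I_n.+1 := (il k).1; pose l (k : 'I_n.+1) := (il k).2.
have ls k : l k 0 (s k) != 0.
  have [lk lb lmin] := ilP k; apply/eqP => e; apply: (lmin (l k)) => // j.
  by rewrite leq_eqVlt => /orP [/eqP/val_inj <-|/lb].
(* If the last nonzero coordinates coincided, subtracting a multiple of [l k'] from [l k] would
   cancel that of [l k] without changing its leading 1 in column [k], against minimality. *)
have s_lt (k k' : 'I_n.+1) : (k < k')%N -> s k <> s k'.
  move=> kk' e; have [lk lb lmin] := ilP k; have [lk' lb' _] := ilP k'.
  apply: (lmin (l k - (l k 0 (s k) / l k' 0 (s k')) *: l k')).
    split=> [|j jk]; rewrite mulmxBl -scalemxAl mxE [X in _ + X]mxE [X in - X]mxE.
      by rewrite (proj1 lk) (proj2 lk') // mulr0 subr0.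
    by rewrite (proj2 lk) // (proj2 lk') ?mulr0 ?subr0 //; apply: ltn_trans kk'.
  move=> j; rewrite leq_eqVlt mxE [X in _ + X]mxE [X in - X]mxE => /orP [/eqP/val_inj <-|ij].
    by rewrite -/(s k) -e divfK ?subrr // e ls.
  by rewrite lb // (lb' j) ?mulr0 ?subr0 // -/(s k') -e.
have s_inj : injective s.
  move=> k k' e; case: (ltngtP k k') => [/s_lt/(_ e)|/s_lt/(_ (esym e))|/val_inj] //.
pose sp : 'S_n.+1 := perm s_inj.
pose L : 'M[F]_n.+1 := \matrix_(i, j) l ((sp^-1)%g i) 0 j.
have Lsp : forall k, row k (row_perm sp L) = l k.
  by move=> k; apply/rowP => j; rewrite !mxE permK.
have Ltrig : is_trig_mx L.
  apply/is_trig_mxP => i j ij; rewrite mxE.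
  have [_ lb _] := ilP ((sp^-1)%g i); apply: lb.
  by rewrite -/(s _) -(permE s_inj) permKV.
have Gk k j : (row_perm sp L *m G) k j = (l k *m G) 0 j by rewrite -Lsp -row_mul [RHS]mxE.
exists L, sp; split=> // [|k|k j jk].
- rewrite unitmxE det_trig // unitfE; apply/prodf_neq0 => i _; rewrite mxE.
  have := ls ((sp^-1)%g i); by rewrite -(permE s_inj) permKV.
- by rewrite Gk; have [[]] := ilP k.
by rewrite Gk; have [[_ ->]] := ilP k.
Qed.

(** Block multiplication: the terms leaving the corner meet the zero block of [B] below it. *)
Lemma ul_sub_mul (R : pzSemiRingType) n m (A B : 'M[R]_n.+1) : (m < n.+1)%N ->
    (forall j l : 'I_n.+1, (m < j)%N -> (l <= m)%N -> B j l = 0) ->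
  ul_sub m.+1 (A *m B) = ul_sub m.+1 A *m ul_sub m.+1 B.
Proof.
move=> mn B0; apply/matrixP => a c; rewrite !mxE.
have -> : \sum_(j < n.+1) A (inord a) j * B j (inord c)
    = \sum_(0 <= j < n.+1) A (inord a) (inord j) * B (inord j) (inord c).
  by rewrite big_mkord; apply: eq_bigr => j _; rewrite inord_val.
rewrite (@big_cat_nat _ _ _ m.+1) //= [X in _ + X]big1_seq ?addr0.
  by rewrite big_mkord; apply: eq_bigr => j _; rewrite !mxE.
move=> j /andP [_]; rewrite mem_index_iota => /andP [mj jn]; rewrite B0 ?mulr0 ?inordK //.
  by rewrite -ltnS ltn_ord.
exact: leq_trans (ltn_ord c) mn.
Qed.

(** The size bound allows exactly the powers [y^0, ..., y^m] that occur in the differentials of the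
    traces of the powers 1 to [m+1] of [y]. *)
Definition border_separated (F : fieldType) m (y : 'M[F]_m.+1) :=
  forall p : {poly F}, (size p <= m.+1)%N ->
    (forall a, horner_mx y p a ord_max = 0) ->
    (forall a, horner_mx y p ord_max a = 0) -> p = 0.

Lemma horner_mx_diag_sim (F : fieldType) m (K H : 'M[F]_m.+1) (d : 'rV_m.+1) p :
  K *m H = 1%:M ->
  horner_mx (K *m diag_mx d *m H) p = K *m diag_mx (map_mx (horner p) d) *m H.
Proof.
move=> KH; have [Ku Hu] := mulmx1_unit KH.
have -> : K = invmx H by rewrite -[LHS]mulmx1 -(mulmxV Hu) mulmxA KH mul1mx.
by rewrite horner_mx_uconjC // horner_mx_diag.
Qed.

(** The rows of [H] and the columns of [K] are left and right eigenvectors. A zero last column of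
    [p(y)] gives [p(d_k) H_(k,m) = 0], a zero last row gives [K_(m,k) p(d_k) = 0]; so [p] has [m+1]
    distinct roots, too many for its degree. *)
Lemma diag_border_separated (F : fieldType) m (K H : 'M[F]_m.+1) (d : 'rV_m.+1) :
    K *m H = 1%:M -> injective (d 0) ->
    (forall k, (H k ord_max != 0) || (K ord_max k != 0)) ->
  border_separated (K *m diag_mx d *m H).
Proof.
move=> KH dinj KHk p sp; rewrite horner_mx_diag_sim //.
set Y := K *m _ *m H => pcol prow.
have HK : H *m K = 1%:M by apply: mulmx1C.
have rootp k : root p (d 0 k).
  rewrite /root; case/orP: (KHk k) => nz.
    have : (H *m Y) k ord_max = 0 by rewrite mxE big1 // => j _; rewrite pcol mulr0.
    rewrite /Y !mulmxA HK mul1mx mul_diag_mx mxE mxE => /eqP.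
    by rewrite mulf_eq0 (negbTE nz) orbF.
  have : (Y *m K) ord_max k = 0 by rewrite mxE big1 // => j _; rewrite prow mul0r.
  rewrite /Y -!mulmxA HK mulmx1 mul_mx_diag mxE mxE => /eqP.
  by rewrite mulf_eq0 (negbTE nz).
apply: (@roots_geq_poly_eq0 _ p [seq d 0 k | k <- enum 'I_m.+1]).
- by apply/allP => _ /mapP [k _ ->].
- by rewrite map_inj_uniq ?enum_uniq.
by rewrite size_map size_enum_ord.
Qed.

(* In the basis [u_k] of rows of [U], adapted to both flags, the eigenvectors
   [h_k] of [x] are the rows of [H = H0 U]: [h_m] is the sum of [u_m] and of the
   [u_k], [k < m], coming before it in the flag of [G], so that
   [e_m = h_m - \sum h_k] on the first [m] coordinates; the [u_k], [k < m],
   coming after [u_m] are given a nonzero [m]-th coordinate by adding [u_m]. *)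
Lemma border_separated_exists (F : numFieldType) n m (G : 'M[F]_n.+1) :
    G \in unitmx -> (m < n.+1)%N ->
  exists2 x, is_trig_mx (G *m x *m invmx G) & border_separated (ul_sub m.+1 x).
Proof.
move=> Gu mn; have [L [s [Lt Lu U1 U0]]] := bruhat_row_perm Gu.
set U := row_perm s L *m G in U1 U0.
pose mo : 'I_n.+1 := Ordinal mn.
pose t (l : 'I_n.+1) := (l < m)%N && (s l < s mo)%N.
pose z (k : 'I_n.+1) := [&& (k < m)%N, (s mo < s k)%N & U k mo == 0].
pose H0 : 'M[F]_n.+1 :=
  \matrix_(k, l) ((k == l)%:R + ((l == mo) && z k)%:R + ((k == mo) && t l)%:R).
pose H := H0 *m U.
pose H1 := row_perm s^-1 (col_perm s^-1 H0).
have H1E i j : H1 i j = H0 (s^-1 i)%g (s^-1 j)%g by rewrite !mxE.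
(* Off the diagonal, [H0 k l] is nonzero only if [s l < s k]; reordered by [s], it is unitriangular,
   so the rows of [H] stay adapted to the flag of [G]. *)
have H1t : is_trig_mx H1.
  apply/is_trig_mxP => i j ij; rewrite H1E !mxE (inj_eq perm_inj) -val_eqE ltn_eqF //= add0r.
  rewrite /z /t !permKV.
  case: eqP => [jm|_] /=.
    rewrite -jm permKV [(j < i)%N]ltnNge (ltnW ij) /= andbF add0r ltnn.
    by rewrite (inj_eq perm_inj) -val_eqE ltn_eqF.
  rewrite add0r; case: eqP => [im|_] //=.
  by rewrite -im permKV [(j < i)%N]ltnNge (ltnW ij) andbF.
have H1u : H1 \in unitmx.
  rewrite unitmxE det_trig // big1 ?unitr1 // => i _.
  by rewrite H1E mxE eqxx /z /t; case: eqP => [->|_]; rewrite /= ?ltnn ?addr0.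
pose M := H1 *m L.
have Mu : M \in unitmx by rewrite unitmx_mul H1u.
have Mt : is_trig_mx M by apply: trig_mx_mul.
have HM : H = row_perm s (M *m G).
  rewrite /H /U /M /H1 !row_permE col_permE invgK !mulmxA.
  by rewrite -perm_mxM mulgV perm_mx1 mul1mx.
(* The eigenvalues [0, ..., n] are distinct in characteristic zero. *)
pose D : 'M[F]_n.+1 := diag_mx (\row_i (i%:R : F)).
pose x := invmx G *m invmx M *m D *m M *m G.
exists x.
  have -> : G *m x *m invmx G = invmx M *m D *m M.
    by rewrite /x !mulmxA mulmxV // mul1mx mulmxK.
  by rewrite !trig_mx_mul ?trig_mx_inv ?diag_mx_is_trig.
have Hu : H \in unitmx by rewrite HM row_permE unitmx_mul unitmx_perm unitmx_mul Mu.
pose d (k : 'I_n.+1) : F := (s k)%:R.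
have Hx : H *m x = diag_mx (\row_k d k) *m H.
  have MGx : M *m G *m x = D *m (M *m G).
    by rewrite /x !mulmxA mulmxK // mulmxV // mul1mx.
  rewrite HM row_permE -mulmxA MGx -!row_permE; apply/matrixP => k j.
  by rewrite mxE !mul_diag_mx mxE [in RHS]mxE !mxE.
have HE k l : H k l = U k l + (z k)%:R * U mo l + (k == mo)%:R * \sum_(j | t j) U j l.
  rewrite /H mxE.
  transitivity (\sum_j ((k == j)%:R * U j l + ((j == mo) && z k)%:R * U j l
      + ((k == mo) && t j)%:R * U j l)).
    by apply: eq_bigr => j _; rewrite mxE !mulrDl.
  rewrite !big_split /=; congr (_ + _ + _).
  - rewrite (bigD1 k) //= eqxx mul1r big1 ?addr0 // => j jk.
    by rewrite eq_sym (negbTE jk) mul0r.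
  - rewrite (bigD1 mo) //= eqxx /= big1 ?addr0 // => j jk.
    by rewrite (negbTE jk) mul0r.
  rewrite big_distrr /= [RHS]big_mkcond; apply: eq_bigr => j _.
  by case: (k == mo); case: (t j); rewrite /= ?mul0r ?mul1r.
(* Hence corners multiply, and the first [m+1] rows of [H], truncated, form an eigenbasis for the
   corner of [x]. *)
have Hblock (k l : 'I_n.+1) : (m < k)%N -> (l <= m)%N -> H k l = 0.
  move=> mk lm; rewrite HE U0 ?(leq_ltn_trans lm) // /z -val_eqE /= gtn_eqF //.
  by rewrite [(k < m)%N]ltnNge (ltnW mk) /= !mul0r !addr0.
pose iH := invmx H.
have ulHK : ul_sub m.+1 iH *m ul_sub m.+1 H = 1%:M.
  rewrite -ul_sub_mul // mulVmx //; apply/matrixP => a c; rewrite !mxE -!val_eqE /=.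
  by rewrite !inordK ?(leq_trans (ltn_ord _) mn).
have ulx : ul_sub m.+1 x
    = ul_sub m.+1 iH *m diag_mx (\row_k d (inord k)) *m ul_sub m.+1 H.
  have -> : x = iH *m (diag_mx (\row_k d k) *m H) by rewrite -Hx mulKmx.
  rewrite ul_sub_mul // => [|j l mj lm]; last by rewrite mul_diag_mx mxE mxE Hblock ?mulr0.
  rewrite -mulmxA; congr (_ *m _); apply/matrixP => a c.
  by rewrite !mul_diag_mx !mxE.
(* Every row holds the coordinates of [u_m] in the basis of rows of [H]. Truncated to the corner,
   [u_m] is the last basis vector, so these coordinates are the last row of the inverse of the
   corner of [H]. *)
pose A : 'M[F]_n.+1 := \matrix_(i, k) ((k == mo)%:R - (t k)%:R).
have AH i l : (A *m H) i l = U mo l.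
  have -> : (A *m H) i l = H mo l - \sum_(k | t k) H k l.
    rewrite mxE; transitivity (\sum_k ((k == mo)%:R * H k l - (t k)%:R * H k l)).
      by apply: eq_bigr => k _; rewrite mxE mulrBl.
    rewrite sumrB (bigD1 mo) //= eqxx mul1r big1 ?addr0 => [|k /negbTE ->]; last by rewrite mul0r.
    congr (_ - _); rewrite [RHS]big_mkcond; apply: eq_bigr => k _.
    by case: (t k); rewrite ?mul0r ?mul1r.
  rewrite HE /z /= ltnn eqxx /= mul0r mul1r addr0.
  suff -> : \sum_(k | t k) H k l = \sum_(k | t k) U k l by rewrite addrK.
  apply: eq_bigr => k /andP [km sk].
  by rewrite HE /z [(s mo < _)%N]ltnNge (ltnW sk) /= andbF -val_eqE ltn_eqF // !mul0r !addr0.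
have rowA : row ord_max (ul_sub m.+1 A) = row ord_max (ul_sub m.+1 iH).
  rewrite [RHS]rowE; have -> : delta_mx 0 ord_max = row ord_max (ul_sub m.+1 A) *m ul_sub m.+1 H.
    rewrite -row_mul -ul_sub_mul //; apply/rowP => c; rewrite [LHS]mxE [RHS]mxE [RHS]mxE AH eqxx /=.
    case: (ltngtP c m) => [cm|cm|cm].
    - by rewrite U0 ?inordK ?(leq_trans (ltn_ord c) mn) // -val_eqE ltn_eqF.
    - by move: (ltn_ord c); rewrite ltnS leqNgt cm.
    by rewrite -val_eqE /= cm eqxx (_ : inord m = mo) ?U1 //; apply: val_inj; rewrite /= inordK.
  by rewrite -mulmxA (mulmx1C ulHK) mulmx1.
have ikm : inord (@ord_max m) = mo by apply: val_inj; rewrite /= inordK.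
rewrite ulx; apply: diag_border_separated => // [a c|k].
  rewrite !mxE => /eqP; rewrite eqr_nat => /eqP/val_inj/perm_inj.
  move/(congr1 val) => /=; rewrite !inordK ?(leq_trans (ltn_ord _) mn) //; exact: val_inj.
have -> : ul_sub m.+1 iH ord_max k = A mo (inord k).
  by move/rowP/(_ k): rowA; rewrite !mxE.
have -> : ul_sub m.+1 H k ord_max = H (inord k) mo by rewrite mxE ikm.
rewrite [A _ _]mxE HE U1 mulr1.
case: (eqVneq (inord k) mo) => [->|km]; first by rewrite /t /= !ltnn /= subr0 oner_eq0 orbT.
rewrite -val_eqE /= in km.
have {}km : (@inord n k < m)%N.
  by rewrite ltn_neqAle km /= inordK ?(leq_trans (ltn_ord k) mn) // -ltnS.
rewrite mul0r addr0 sub0r oppr_eq0 /t /z km /=.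
(* Before [u_m] in the flag of [G], the coefficient of [h_k] is -1; after it, the last coordinate of
   [h_k] is that of [u_k], or 1 if that one vanishes. *)
case: (ltngtP (s (inord k)) (s mo)) => [_|_|/val_inj/perm_inj e].
- by rewrite oner_eq0 orbT.
- by rewrite /= eqxx orbF; case: (eqVneq (U _ _) 0) => [->|nz]; rewrite /= ?add0r ?oner_eq0 ?addr0.
by move: km; rewrite e ltnn.
Qed.

(** * Openness *)

(** The matrix, in the basis of powers, of the linear map sending a polynomial [p] of degree at most
    [m] to the last row and last column of [p(y)]. Separation is its injectivity, hence a rank
    condition. *)
Definition border_mx (R : nzRingType) m (y : 'M[R]_m.+1) : 'M[R]_(m.+1, m.+1 + m.+1) :=
  row_mx (\matrix_(k, a) (y ^+ k) ord_max a) (\matrix_(k, a) (y ^+ k) a ord_max).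

Lemma border_mx_map (R S : nzRingType) (f : {rmorphism R -> S}) m (y : 'M[R]_m.+1) :
  border_mx (map_mx f y) = map_mx f (border_mx y).
Proof.
rewrite map_row_mx; congr row_mx; apply/matrixP => k a;
  by rewrite !mxE -(rmorphXn (map_mx f)) mxE.
Qed.

Lemma horner_mx_rVpoly (F : fieldType) m (y : 'M[F]_m.+1) d (u : 'rV_d) :
  horner_mx y (rVpoly u) = \sum_k u 0 k *: y ^+ k.
Proof.
rewrite horner_rVpoly mulmx_sum_row linear_sum; apply: eq_bigr => k _.
by rewrite linearZ /= rowK mxvecK.
Qed.

Lemma mul_border_mx (F : fieldType) m (y : 'M[F]_m.+1) (u : 'rV_m.+1) :
  u *m border_mx y = row_mx (\row_a horner_mx y (rVpoly u) ord_max a)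
                            (\row_a horner_mx y (rVpoly u) a ord_max).
Proof.
rewrite mul_mx_row horner_mx_rVpoly; congr row_mx; apply/rowP => a; rewrite !mxE summxE;
  by apply: eq_bigr => k _; rewrite !mxE.
Qed.

Lemma border_separatedP (F : fieldType) m (y : 'M[F]_m.+1) :
  border_separated y <-> row_free (border_mx y).
Proof.
split=> [sep|rf p sp pcol prow].
  apply: inj_row_free => u; rewrite mul_border_mx -[0]row_mx0 => /eq_row_mx [e1 e2].
  apply: (can_inj rVpolyK); rewrite raddf0; apply: sep => [|a|a].
  - exact: size_poly.
  - by move/rowP/(_ a): e2; rewrite !mxE.
  by move/rowP/(_ a): e1; rewrite !mxE.
have e : poly_rV p *m border_mx y = 0.
  rewrite mul_border_mx poly_rV_K // -[RHS]row_mx0.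
  by congr row_mx; apply/rowP => a; rewrite !mxE ?pcol ?prow.
by rewrite -(poly_rV_K sp) (row_free_inj rf (etrans e (esym (mul0mx _ _)))) raddf0.
Qed.

(** Let [R] be a right inverse of the border matrix at [t0]. The determinant of the border matrix at
    [t] times [R] is a polynomial in [t], equal to 1 at [t0]; where it is nonzero, a right inverse
    exists again. *)
Lemma border_separated_open (F : fieldType) n m (x z : 'M[F]_n.+1) t0 :
    border_separated (ul_sub m.+1 (x + t0 *: z)) ->
  exists2 q : {poly F}, q != 0 &
    forall t, q.[t] != 0 -> border_separated (ul_sub m.+1 (x + t *: z)).
Proof.
move=> /border_separatedP /row_freeP [R bR].
pose Y := ul_sub m.+1 (map_mx polyC x + 'X *: map_mx polyC z).
pose q := \det (border_mx Y *m map_mx polyC R).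
have Yt t : map_mx (horner_eval t) Y = ul_sub m.+1 (x + t *: z).
  by apply/matrixP => a c; rewrite !mxE /= /horner_eval !hornerE.
have qt t : q.[t] = \det (border_mx (ul_sub m.+1 (x + t *: z)) *m R).
  rewrite -/(horner_eval t q) -det_map_mx map_mxM -border_mx_map Yt.
  by congr (\det (_ *m _)); apply/matrixP => a c; rewrite !mxE /= /horner_eval hornerC.
exists q => [|t].
  by apply: contra_eq_neq (qt t0) => ->; rewrite bR det1 horner0 eq_sym oner_eq0.
rewrite qt -unitfE -unitmxE => u; apply/border_separatedP/row_freeP.
by exists (R *m invmx (border_mx (ul_sub m.+1 (x + t *: z)) *m R)); rewrite mulmxA mulmxV.
Qed.

Lemma exists_nonroot (F : numFieldType) (q : {poly F}) : q != 0 -> exists t, q.[t] != 0.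
Proof.
move=> q0; pose s := [seq i%:R : F | i <- iota 0 (size q)].
have us : uniq s.
  by rewrite map_inj_uniq ?iota_uniq // => i j /eqP; rewrite eqr_nat => /eqP.
have : ~~ all (root q) s.
  apply/negP => rs; have := max_poly_roots q0 rs us.
  by rewrite size_map size_iota ltnn.
by case/allPn => t _; exists t.
Qed.

(** Corners are added one at a time. On the line from [x], good for the earlier corners, to [x'],
    good for the new one, each corner excludes only the roots of a nonzero polynomial; a common
    nonroot exists over an infinite field. *)
Lemma border_separated_generic (F : numFieldType) n (b : 'M[F]_n.+1 -> Prop) :
    (forall x y t, b x -> b y -> b (x + t *: (y - x))) ->
    (forall m, (m < n.+1)%N -> exists2 x, b x & border_separated (ul_sub m.+1 x)) ->
  exists2 x, b x & forall m, (m < n.+1)%N -> border_separated (ul_sub m.+1 x).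
Proof.
move=> bline bex.
suff H k : (k <= n.+1)%N ->
    exists2 x, b x & forall m, (m < k)%N -> border_separated (ul_sub m.+1 x).
  exact: H.
elim: k => [|k IH] kn; first by have [x bx _] := bex 0 isT; exists x.
have [x bx xk] := IH (ltnW kn); have [x' bx' x'k] := bex k kn.
have open j : (j <= k.+1)%N -> exists2 q : {poly F}, q != 0 & forall m, (m < j)%N ->
    forall t, q.[t] != 0 -> border_separated (ul_sub m.+1 (x + t *: (x' - x))).
  elim: j => [|j IHj] jk; first by exists 1; rewrite ?oner_eq0.
  have [q q0 qP] := IHj (ltnW jk).
  (* The new corner is good at parameter 1, the earlier ones at parameter 0. *)
  have [r r0 rP] : exists2 r : {poly F}, r != 0 & forall t, r.[t] != 0 ->
      border_separated (ul_sub j.+1 (x + t *: (x' - x))).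
    have [e|/eqP ne] := eqVneq j k.
      by apply: (@border_separated_open _ _ _ _ _ 1); rewrite scale1r addrC subrK e.
    apply: (@border_separated_open _ _ _ _ _ 0); rewrite scale0r addr0; apply: xk.
    by rewrite ltn_neqAle -ltnS jk andbT; apply/eqP.
  exists (q * r) => [|m]; first by rewrite mulf_neq0.
  rewrite ltnS leq_eqVlt => /orP [/eqP ->|mj] t; rewrite hornerM mulf_eq0 negb_or => /andP [qt rt].
    exact: rP.
  exact: qP.
have [q q0 qP] := open k.+1 (leqnn _); have [t qt] := exists_nonroot q0.
by exists (x + t *: (x' - x)) => [|m mk]; [apply: bline|apply: qP].
Qed.

(** * Differentials of the functions f_{i,j} *)

(** The Leibniz rule for the derivative at 0. *)
Lemma map_coefp1_mul (R : nzRingType) m n p (A : 'M[{poly R}]_(m, n)) (B : 'M_(n, p)) :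
  map_mx (coefp 1) (A *m B)
    = map_mx (coefp 0) A *m map_mx (coefp 1) B + map_mx (coefp 1) A *m map_mx (coefp 0) B.
Proof.
apply/matrixP => i j; rewrite !mxE /= coef_sum -big_split; apply: eq_bigr => k _.
by rewrite !mxE coefM !big_ord_recl big_ord0 /= addr0.
Qed.

Lemma map_coefp0_mul (R : nzRingType) m n p (A : 'M[{poly R}]_(m, n)) (B : 'M_(n, p)) :
  map_mx (coefp 0) (A *m B) = map_mx (coefp 0) A *m map_mx (coefp 0) B.
Proof.
apply/matrixP => i j; rewrite !mxE /= coef_sum; apply: eq_bigr => k _.
by rewrite !mxE coefM big_ord1.
Qed.

Lemma trace_exp_coef1 (R : comNzRingType) m (A B : 'M[R]_m.+1) j :
  (\tr ((map_mx polyC A + 'X *: map_mx polyC B) ^+ j.+1))`_1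
    = j.+1%:R * \tr (A ^+ j *m B).
Proof.
set P := _ + _.
have P0 : map_mx (coefp 0) P = A.
  by apply/matrixP => a c; rewrite /P !mxE /= coefD coefC coefXM addr0.
have P1 : map_mx (coefp 1) P = B.
  by apply/matrixP => a c; rewrite /P !mxE /= coefD coefC coefXM coefC add0r.
have P0X k : map_mx (coefp 0) (P ^+ k) = A ^+ k.
  elim: k => [|k IH].
    rewrite !expr0; apply/matrixP => a c; rewrite !mxE /=.
    by rewrite coefMn coef1.
  by rewrite !exprS -[P * _]/(P *m _) map_coefp0_mul IH P0.
(* The factor [C], commuting with [A], absorbs the powers of [A] split off on the left; cyclicity of
   the trace then moves those on the right of [B]. *)
have trP k C : C *m A = A *m C ->
    \tr (C *m map_mx (coefp 1) (P ^+ k.+1)) = k.+1%:R * \tr (C *m A ^+ k *m B).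
  elim: k C => [|k IH] C CA; first by rewrite expr1 P1 expr0 mulmx1 mul1r.
  rewrite exprS -[P * _]/(P *m _) map_coefp1_mul P0 P1 P0X mulmxDr raddfD /=.
  rewrite mulmxA IH; last by rewrite mulmxA -CA.
  have -> : C *m A *m A ^+ k = C *m A ^+ k.+1 by rewrite -mulmxA exprS.
  have -> : \tr (C *m (B *m A ^+ k.+1)) = \tr (C *m A ^+ k.+1 *m B).
    have CAk : A ^+ k.+1 *m C = C *m A ^+ k.+1 := esym (commrX k.+1 (CA : GRing.comm C A)).
    by rewrite mulmxA mxtrace_mulC mulmxA CAk.
  by rewrite -[in RHS]natr1 mulrDl mul1r.
have := trP j 1%:M; rewrite mul1mx mulmx1 => /(_ erefl); rewrite !mul1mx => <-.
by rewrite /mxtrace coef_sum; apply: eq_bigr => i _; rewrite mxE.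
Qed.

Lemma dfijE n m j (x y : gl n) :
  dfij m.+1 j.+1 x y = j.+1%:R * \tr ((ul_sub m.+1 x) ^+ j *m ul_sub m.+1 y).
Proof.
rewrite -trace_exp_coef1 /dfij; set P := ul_sub _ (_ + _); set Q := _ + _.
suff -> : P = Q by [].
by apply/matrixP => a c; rewrite !mxE.
Qed.

Lemma dfij0 n i j (x y : gl n) : ul_sub i y = 0 -> dfij i j x y = 0.
Proof.
case: i => [|m] y0; first by rewrite /dfij /mxtrace big_ord0 coef0.
case: j => [|j]; last by rewrite dfijE y0 mulmx0 mxtrace0 mulr0.
by rewrite /dfij expr0 mxtrace1 coefMn coef1 mul0rn.
Qed.

Lemma trace_mul_delta (R : comNzRingType) m (Q : 'M[R]_m) a b :
  \tr (Q *m delta_mx a b) = Q b a.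
Proof.
rewrite -(mul_delta_mx (0 : 'I_1)) mulmxA mxtrace_mulC -colE -rowE /mxtrace big_ord1.
by rewrite !mxE.
Qed.

Lemma strongly_regular_border n (x : gl n) :
    (forall m, (m < n.+1)%N -> border_separated (ul_sub m.+1 x)) ->
  strongly_regular x.
Proof.
move=> sep c cE.
suff H r i j : (n.+1 - i < r)%N -> (1 <= j)%N -> (j <= i)%N -> (i <= n.+1)%N -> c i j = 0.
  by move=> i j; apply: H (ltnSn _).
elim: r i j => // r IH [|m] [|j] // ir _ jm mn.
(* With the coefficients of larger corners already zero, a tangent vector vanishing on smaller
   corners turns the relation into [tr (p(X) y) = 0], the factor [k+1] coming from the
   derivative. *)
pose X := ul_sub m.+1 x; pose p := \poly_(k < m.+1) (c m.+1 k.+1 * k.+1%:R).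
have trp (y : gl n) : (forall i, (i <= m)%N -> ul_sub i y = 0) ->
    \tr (horner_mx X p *m ul_sub m.+1 y) = 0.
  move=> y0; rewrite -[RHS](cE y) (bigD1_seq m.+1) ?iota_uniq ?mem_index_iota //=.
  rewrite [X in _ + X]big1_seq ?addr0 => [|i].
    rewrite big_add1 big_mkord /p poly_def rmorph_sum mulmx_suml raddf_sum.
    apply: eq_bigr => k _ /=; rewrite linearZ /= rmorphXn /= horner_mx_X.
    by rewrite -scalemxAl linearZ /= dfijE mulrA.
  rewrite mem_index_iota => /andP [im /andP [i_gt0 ilt]]; rewrite big1_seq // => k.
  rewrite mem_index_iota => /andP [_ /andP [k_gt0 ki]].
  case: (ltnP i m.+1) => im'; first by rewrite dfij0 ?mulr0 // y0.
  by rewrite IH ?mul0r //; lia.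
have wd (a : 'I_m.+1) : (inord a : 'I_n.+1) = a :> nat.
  by rewrite inordK // (leq_trans (ltn_ord a) mn).
have ul_delta (a b : 'I_m.+1) :
    ul_sub m.+1 (delta_mx (inord a) (inord b) : gl n) = delta_mx a b.
  by apply/matrixP => k l; rewrite !mxE -!val_eqE /= !wd.
(* Matrix units in the last row or column of the corner are such tangent vectors; they read off the
   last column and last row of [p(X)]. *)
have ul_delta0 (a b : 'I_m.+1) i : (a == ord_max) || (b == ord_max) -> (i <= m)%N ->
    ul_sub i (delta_mx (inord a) (inord b) : gl n) = 0.
  move=> ab im; apply/matrixP => k l; rewrite !mxE -!val_eqE /= !wd.
  have kn (k' : 'I_i) : (inord k' : 'I_n.+1) = k' :> nat by rewrite inordK //; have := ltn_ord k'; lia.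
  have := ltn_ord k; have := ltn_ord l; rewrite !kn.
  by case/orP: ab => /eqP -> lm km; [rewrite [X in X && _]ltn_eqF //|rewrite [X in _ && X]ltn_eqF ?andbF //]; apply: leq_trans im.
have p0 : p = 0.
  apply: (sep m mn) => [|a|a]; first exact: size_poly.
    rewrite -trace_mul_delta -ul_delta; apply: trp => i im.
    by rewrite ul_delta0 // eqxx ?orbT.
  rewrite -trace_mul_delta -ul_delta; apply: trp => i im.
  by rewrite ul_delta0 // eqxx ?orbT.
have := congr1 (fun q : {poly CC} => q`_j) p0; rewrite coef0 coef_poly jm => /eqP.
by rewrite mulf_eq0 pnatr_eq0 orbF => /eqP.
Qed.

Theorem theorem5p3 (n : nat) (b : gl n -> Prop) :
  is_borel b -> exists x : gl n, b x /\ strongly_regular x.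
Proof.
move=> bb; have [[[_ [bD bZ]] _] _] := bb.
have [G Gu bG] := borel_conj_trig bb.
have [x y t bx b_y|m mn|x bx xsep] := @border_separated_generic _ n b.
- by rewrite -scaleN1r; exact: bD _ _ bx (bZ _ _ (bD _ _ b_y (bZ _ _ bx))).
- by have [x /bG bx xsep] := border_separated_exists Gu mn; exists x.
by exists x; split=> //; apply: strongly_regular_border.
Qed.
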